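(* Let $k\geq 0$ be an integer. Every interval graph $G$ with $\omega(G)\leq k+1$ has a maximum independent set in which every vertex has degree at most $2k$ in $G$. That is, $\alpha_{2k}(G)=\alpha(G)$.
   Context: All graphs are finite, undirected, and simple. A graph $G$ is an interval graph if one can assign to each vertex $v\in V(G)$ a closed interval $[L(v),R(v)]\subseteq\mathbb{R}$ such that, for distinct vertices $v,w$, $vw\in E(G)$ if and only if $[L(v),R(v)]\cap[L(w),R(w)]\neq\emptyset$. $\omega(G)$ denotes the maximum size of a clique of $G$. $\alpha(G)$ is the maximum cardinality of an independent set of $G$, and $\alpha_d(G)$ is the maximum cardinality of an independent set of $G$ all of whose vertices have degree at most $d$ in $G$. *)

(* Defs.v *)
From mathcomp Require Import all_boot all_order all_algebra.
From mathcomp Require Import classical_sets set_interval reals.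

Set Implicit Arguments.
Unset Strict Implicit.
Unset Printing Implicit Defensive.

Record sgraph := SGraph {
  vertex :> finType;
  adj : rel vertex;
  adj_sym : symmetric adj;
  adj_irr : irreflexive adj
}.

Definition degree (G : sgraph) (v : G) : nat := #|[set w | adj v w]|.

Definition clique (G : sgraph) (A : {set G}) : bool :=
  [forall v in A, forall w in A, (v != w) ==> adj v w].

Definition independent (G : sgraph) (A : {set G}) : bool :=
  [forall v in A, forall w in A, ~~ adj v w].

Definition degree_at_most (G : sgraph) (d : nat) (A : {set G}) : bool :=
  [forall v in A, degree v <= d].

Definition omega (G : sgraph) : nat := \max_(A : {set G} | clique A) #|A|.

Definition alpha (G : sgraph) : nat := \max_(A : {set G} | independent A) #|A|.

Definition alpha_deg (d : nat) (G : sgraph) : nat :=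
  \max_(A : {set G} | independent A && degree_at_most d A) #|A|.

Definition interval_graph (R : realType) (G : sgraph) : Prop :=
  exists L U : G -> R,
    (forall v, (L v <= U v)%R) /\
    (forall v w, v != w ->
       (adj v w <-> (`[L v, U v] `&` `[L w, U w] !=set0)%classic)).

(* Main.v *)
Require Import Defs.
From mathcomp Require Import all_boot all_order all_algebra.
From mathcomp Require Import classical_sets set_interval reals.

(** Among the maximum independent sets, take one of least total interval
    length.  No neighbour of a chosen vertex [v] has its interval strictly inside
    that of [v], since exchanging the two would preserve independence and
    shorten the set.  So each neighbour's interval contains an endpoint of
    the interval of [v]; the intervals through a given point form a clique,
    which leaves at most [k] neighbours at each of the two endpoints. *)

Set Implicit Arguments.
Unset Strict Implicit.
Unset Printing Implicit Defensive.

Import Order.TTheory GRing.Theory Num.Theory.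

Lemma leq_bigmax_set (T : finType) (P : pred {set T}) (A : {set T}) :
  P A -> #|A| <= \max_(B : {set T} | P B) #|B|.
Proof. exact: (leq_bigmax_cond A). Qed.

Lemma alpha_deg_le_alpha (d : nat) (G : sgraph) : alpha_deg d G <= alpha G.
Proof. by apply/bigmax_leqP => A /andP[iA _]; exact: leq_bigmax_set. Qed.

Lemma alpha_attained (G : sgraph) :
  exists2 I : {set G}, independent I & #|I| = alpha G.
Proof.
have i0 : independent (finset.set0 : {set G}).
  by apply/forall_inP => v; rewrite inE.
have gt0 : 0 < #|@independent G| by apply/card_gt0P; exists finset.set0.
have [I iI maxI] := eq_bigmax_cond (fun A : {set G} => #|A|) gt0.
by exists I.
Qed.

(** A member of [I] other than [v] that was adjacent to [w] would also be adjacent to [v], which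
    independence of [I] forbids. *)
Lemma independent_exchange (G : sgraph) (I : {set G}) (v w : G) :
    independent I -> v \in I ->
    (forall u, u != v -> adj u w -> adj u v) ->
  independent (w |: I :\ v).
Proof.
move=> iI vI sub.
have nadj a b : a \in I -> b \in I -> ~~ adj a b.
  by move=> aI; move: b; apply/forall_inP; exact: (forall_inP iI).
have nw a : a != v -> a \in I -> ~~ adj a w.
  by move=> av aI; apply: contra (nadj a v aI vI); exact: sub.
apply/forall_inP => a; rewrite !inE => /orP[/eqP->|/andP[av aI]];
  apply/forall_inP => b; rewrite !inE => /orP[/eqP->|/andP[bv bI]].
- by rewrite adj_irr.
- by rewrite adj_sym nw.
- exact: nw.
- exact: nadj.
Qed.

Section IntervalRepresentation.
Variables (R : realType) (G : sgraph) (L U : G -> R).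
Hypothesis adjP : forall v w, v != w ->
  (adj v w <-> (`[L v, U v] `&` `[L w, U w] !=set0)%classic).

Local Open Scope ring_scope.

Lemma adj_common_point (v w : G) : v != w ->
  adj v w <-> exists x, (L v <= x <= U v) && (L w <= x <= U w).
Proof.
move=> vw; rewrite (adjP vw); split=> -[x].
  by move=> [/= xv xw]; exists x; move: xv xw; rewrite !in_itv /= => -> ->.
by move=> /andP[xv xw]; exists x; split; rewrite /= in_itv /= ?xv ?xw.
Qed.

Lemma card_stab_le_omega (x : R) :
  (#|[set w | (L w <= x <= U w)%R]| <= omega G)%N.
Proof.
apply: leq_bigmax_set; apply/forall_inP => v; rewrite inE => xv.
apply/forall_inP => w; rewrite inE => xw; apply/implyP => vw.
by apply/(adj_common_point vw); exists x; rewrite xv xw.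
Qed.

(** A common point already yields [L v <= U w] and [L w <= U v]. Only the order of the two left ends
    and that of the two right ends stay open, and nesting is the case where both endpoint conditions
    fail. *)
Lemma adj_endpoint_or_nested (v w : G) : adj v w ->
  [|| L w <= L v <= U w, L w <= U v <= U w | (L v < L w) && (U w < U v)].
Proof.
have [->|vw] := eqVneq v w; first by rewrite adj_irr.
move=> /(adj_common_point vw)[x /andP[/andP[lvx xuv] /andP[lwx xuw]]].
rewrite (le_trans lvx xuw) (le_trans lwx xuv) andbT /=.
by case: leP => //= _; case: leP.
Qed.

(** Every point of the inner interval lies in the outer one. This supplies the hypothesis on
    neighbours in [independent_exchange]. *)
Lemma adj_nested (u v w : G) : L v < L w -> U w < U v ->
  u != v -> adj u w -> adj u v.
Proof.
move=> lvw uwv uv; have [->|uw] := eqVneq u w; first by rewrite adj_irr.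
move=> /(adj_common_point uw)[x /andP[xu /andP[lwx xuw]]].
apply/(adj_common_point uv); exists x; rewrite xu /=.
by rewrite (le_trans (ltW lvw) lwx) (le_trans xuw (ltW uwv)).
Qed.

Lemma degree_le_of_no_nested (k : nat) (v : G) :
    (omega G <= k.+1)%N -> L v <= U v ->
    (forall w, adj v w -> ~~ ((L v < L w) && (U w < U v))) ->
  (degree v <= 2 * k)%N.
Proof.
move=> homega luv no_nested.
(* The interval of [v] contains both of its endpoints, so removing [v] from the clique at either one
   lowers the bound from [k.+1] to [k]. *)
pose S x := [set w | L w <= x <= U w] :\ v.
have cardS x : L v <= x <= U v -> (#|S x| <= k)%N.
  move=> xv; have := leq_trans (card_stab_le_omega x) homega.
  by rewrite (cardsD1 v) inE xv.
rewrite mul2n -addnn.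
apply: (@leq_trans (#|S (L v)| + #|S (U v)|)); last first.
  by apply: leq_add; apply: cardS; rewrite lexx luv.
apply: leq_trans (leq_card_setU _ _); apply: subset_leq_card.
apply/fintype.subsetP => w; rewrite !inE => vw.
have -> /= : w != v by apply: contraTneq vw => ->; rewrite adj_irr.
have := adj_endpoint_or_nested vw.
by rewrite (negbTE (no_nested w vw)) orbF.
Qed.

Lemma exists_max_independent_no_nested :
  exists I : {set G}, [/\ independent I, #|I| = alpha G &
    forall v w, v \in I -> adj v w -> ~~ ((L v < L w) && (U w < U v))].
Proof.
have [I0 iI0 cI0] := alpha_attained G.
pose P (I : {set G}) := independent I && (#|I| == alpha G).
pose len (I : {set G}) := \sum_(v in I) (U v - L v).
have P0 : P I0 by rewrite /P iI0 cI0 eqxx.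
have [I /andP[iI /eqP cI] minI] := @arg_minP _ _ _ I0 P len P0.
exists I; split=> // v w vI vw; apply/negP => /andP[lvw uwv].
(* Since [w] lies outside [I], exchanging [v] for [w] keeps the cardinality, and the new set
   competes in the minimization. *)
have wI : w \notin I.
  by apply: contraL vw => wI; move/forall_inP/(_ v vI)/forall_inP: iI; apply.
have wIv : w \notin I :\ v by rewrite !inE negb_and wI orbT.
have /minI : P (w |: I :\ v).
  rewrite /P cardsU1 wIv -cI (cardsD1 v I) vI eqxx andbT.
  by apply: independent_exchange => // u; exact: adj_nested.
(* Once the sum over [I :\ v] cancels, minimality says that the interval of [w] is at least as long
   as that of [v], contrary to strict nesting. *)
rewrite /len big_setU1 //= (big_setD1 v vI) /= lerD2r leNgt.
by rewrite ltrB // ltW.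
Qed.

End IntervalRepresentation.

Theorem theorem9 (R : realType) (k : nat) (G : sgraph)
    (hG : interval_graph R G) (homega : omega G <= k.+1) :
  (exists I : {set G},
     [/\ independent I, #|I| = alpha G & forall v, v \in I -> degree v <= 2 * k])
  /\ alpha_deg (2 * k) G = alpha G.
Proof.
have [L [U [luv adjP]]] := hG.
have [I [iI cI no_nested]] := exists_max_independent_no_nested adjP.
have degI v : v \in I -> degree v <= 2 * k.
  move=> vI; apply: (degree_le_of_no_nested adjP) => // w.
  exact: no_nested.
split; first by exists I.
apply/eqP; rewrite eqn_leq alpha_deg_le_alpha /= -cI.
by apply: leq_bigmax_set; rewrite iI; apply/forall_inP.
Qed.
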